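(* Let $V\subseteq \mathrm{GF}(2)^E$ and $V'\subseteq \mathrm{GF}(2)^{E'}$ be linear subspaces (for finite sets $E,E'$). If the matroid $M(V)$ is isomorphic to $M(V')$, then $\tilde G_V$ is isomorphic to $\tilde G_{V'}$.
   Context: For $v\in\mathrm{GF}(2)^E$, $\mathrm{supp}(v)=\{e: v_e\neq0\}$; $M(V)$ is the matroid on $E$ whose independent sets are the $F\subseteq E$ such that no nonzero $v\in V$ has $\mathrm{supp}(v)\subseteq F$. Let $b(x,y)=\sum_e x_ey_e$ and $V^\perp=\{w:b(w,v)=0\ \forall v\in V\}$. A subspace $W$ is pedestrian if $W\cap W^\perp=\{0\}$; then $\mathrm{GF}(2)^E=W\oplus W^\perp$ and $Q_W$ denotes the $E\times E$ matrix of the projection onto $W$ along $W^\perp$. Let $\tilde V\subseteq V$ be any subspace with $V=\tilde V\oplus(V\cap V^\perp)$ (such $\tilde V$ is pedestrian). Let $F_{-1}=\bigcup\{\mathrm{supp}(v): v\in V\cap V^\perp\}$ and $F=E\setminus F_{-1}$. The submatrix $Q_{\tilde V}[F,F]$ does not depend on the choice of $\tilde V$. $\tilde G_V$ is the graph with vertex set $F$ and edge set $\{ef: e,f\in F,\ (Q_{\tilde V})_{ef}\neq0\}$ (including a loop at $e$ when $(Q_{\tilde V})_{ee}\neq 0$). *)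

(* Defs.v *)
From HB Require Import structures.
From mathcomp Require Import all_boot all_order all_algebra.

Set Implicit Arguments.
Unset Strict Implicit.
Unset Printing Implicit Defensive.

Import GRing.Theory.
Local Open Scope ring_scope.

(* The regular module ('F_2)^o is convertible to 'F_2; it is what makes the
   space of functions E -> 'F_2 a vectType over 'F_2. *)
Notation gf2 E := {ffun E -> ('F_2)^o}.

Record matroid (E : finType) := Matroid {
  indep : {set {set E}};
  indep0 : set0 \in indep;
  indepS : forall A B : {set E}, A \subset B -> B \in indep -> A \in indep;
  indep_exchange : forall A B : {set E}, A \in indep -> B \in indep ->
    (#|A| < #|B|)%N -> exists2 e, e \in B :\: A & e |: A \in indep
}.

Definition matroid_isom (E E' : finType) (M : matroid E) (M' : matroid E') :=
  exists2 phi : E -> E', bijective phi &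
    forall A : {set E}, (phi @: A \in indep M') = (A \in indep M).

(* No parallel edges; x carries a loop exactly when adj x x. *)
Record looped_graph := LoopedGraph {
  vertex :> finType;
  adj : rel vertex;
  adj_sym : symmetric adj
}.

Definition graph_isom (G G' : looped_graph) :=
  exists2 phi : G -> G', bijective phi &
    forall x y : G, adj (phi x) (phi y) = adj x y.

Section BinarySpaces.

Variable E : finType.
Implicit Types (v w : gf2 E) (V W : {vspace gf2 E}) (A F : {set E}).

Definition supp v : {set E} := [set e | v e != 0].

Definition bform v w : ('F_2)^o := \sum_e v e * w e.

Definition perp V : {vspace gf2 E} :=
  (\bigcap_(v in V) lker (linfun (fun w : gf2 E => bform w v)))%VS.

Fact bform_is_linear v : linear (fun w : gf2 E => bform w v).
Proof.
move=> a x y; rewrite /bform scaler_sumr -big_split /=; apply: eq_bigr => e _.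
by rewrite !ffunE mulrDl -[(a *: x e) * v e]mulrA.
Qed.

Lemma bformC v w : bform v w = bform w v.
Proof. by apply: eq_bigr => e _; rewrite mulrC. Qed.

Lemma linfun_bform v w : linfun (fun w : gf2 E => bform w v) w = bform w v.
Proof.
pose m := GRing.isLinear.Build _ _ _ _ _ (bform_is_linear v).
pose f : {linear gf2 E -> ('F_2)^o} := HB.pack (fun w : gf2 E => bform w v) m.
exact: (lfunE f).
Qed.

Lemma bformDl x y v : bform (x + y) v = bform x v + bform y v.
Proof. by have := bform_is_linear v 1 x y; rewrite !scale1r. Qed.

Lemma bformDr x y v : bform v (x + y) = bform v x + bform v y.
Proof. by rewrite !(bformC v) bformDl. Qed.

Lemma perpP V w : reflect (forall v, v \in V -> bform w v = 0) (w \in perp V).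
Proof.
apply: (iffP idP) => [wV v vV | wV].
  have := subvP (bigcapv_inf v vV (subvv _)) _ wV.
  by rewrite memv_ker linfun_bform => /eqP.
rewrite memvE; apply/subv_bigcapP => v vV.
by rewrite -memvE memv_ker linfun_bform wV.
Qed.

Definition pedestrian W : bool := (W :&: perp W == 0)%VS.

Definition basis_vec (e : E) : gf2 E := [ffun x => (x == e)%:R].

(* Q_W, as the function of its row index e and its column index f. *)
Definition projmx W (e f : E) : 'F_2 := daddv_pi W (perp W) (basis_vec f) e.

Definition radical V : {vspace gf2 E} := (V :&: perp V)%VS.

Definition radical_compl V W : bool :=
  (W + radical V == V)%VS && (W :&: radical V == 0)%VS.

Definition Fminus V : {set E} := \bigcup_(v in radical V) supp v.

Definition Fset V : {set E} := ~: Fminus V.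

(* One particular complement of the radical; by projmx_radical_compl any other
   one gives the same Q[F,F], hence the same graph. *)
Definition tildeV V : {vspace gf2 E} := (V :\: radical V)%VS.

Definition indep_sets V : {set {set E}} :=
  [set F : {set E} | ~~ [exists v : gf2 E, [&& v \in V, v != 0 & supp v \subset F]]].

Lemma indep_setsP V F :
  reflect (forall v, v \in V -> supp v \subset F -> v = 0) (F \in indep_sets V).
Proof.
rewrite inE; apply: (iffP idP) => [/existsPn nF v vV sF | nF].
  by have := nF v; rewrite vV sF andbT /= negbK => /eqP.
apply/existsPn => v; apply/negP => /and3P[vV /negP nz sF].
by apply: nz; rewrite (nF v vV sF).
Qed.

Fact indep_sets0 V : set0 \in indep_sets V.
Proof.
apply/indep_setsP => v _; rewrite subset0 => /eqP s0.
by apply/ffunP => e; have := in_set0 e; rewrite -s0 inE ffunE => /negbFE/eqP.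
Qed.

Fact indep_setsS V A F :
  A \subset F -> F \in indep_sets V -> A \in indep_sets V.
Proof.
move=> AF /indep_setsP iF; apply/indep_setsP => v vV sA.
by apply: iF => //; apply: subset_trans AF.
Qed.

Definition coordsp A : {vspace gf2 E} :=
  <<[seq basis_vec e | e <- enum A]>>%VS.

Lemma bform_basis v e : bform v (basis_vec e) = v e.
Proof.
rewrite /bform (bigD1 e) //= ffunE eqxx mulr1 big1 ?addr0 // => i ne.
by rewrite ffunE (negbTE ne) mulr0.
Qed.

Lemma sum_basis v : v = \sum_e v e *: basis_vec e.
Proof.
apply/ffunP => e; rewrite sum_ffunE (bigD1 e) //= !ffunE eqxx big1.
  by rewrite addr0 -[LHS]mulr1.
by move=> i ne; rewrite !ffunE eq_sym (negbTE ne) scaler0.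
Qed.

Lemma mem_coordsp A v : (v \in coordsp A) = (supp v \subset A).
Proof.
apply/idP/idP => [vA | sA].
  apply/subsetP => e; rewrite inE; apply: contraR => neA.
  suff: (coordsp A <= lker (linfun (fun w : gf2 E => bform w (basis_vec e))))%VS.
    by move/subvP/(_ _ vA); rewrite memv_ker linfun_bform bform_basis.
  apply/span_subvP => _ /mapP[f fA ->]; rewrite memv_ker linfun_bform.
  rewrite bform_basis ffunE; case: (eqVneq e f) => [ef|_]; last by rewrite eqxx.
  by move: fA neA; rewrite mem_enum ef => ->.
rewrite [v]sum_basis; apply: memv_suml => e _.
have [->|nz] := eqVneq (v e) 0; first by rewrite scale0r mem0v.
apply: memvZ; apply/memv_span/map_f; rewrite mem_enum.
by apply: (subsetP sA); rewrite inE.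
Qed.

Lemma dim_coordsp A : \dim (coordsp A) = #|A|.
Proof.
apply/eqP; rewrite eqn_leq; apply/andP; split.
  by rewrite (leq_trans (dim_span _)) // size_map -cardE.
have cap0 : (coordsp A :&: coordsp (~: A) = 0)%VS.
  apply/eqP; rewrite -subv0; apply/subvP => v /memv_capP[].
  rewrite !mem_coordsp => s1 s2; rewrite memv0; apply/eqP/ffunP => e.
  rewrite ffunE; apply/eqP; apply: contraT => nz.
  have ev : e \in supp v by rewrite inE.
  by have := subsetP s2 e ev; rewrite inE (subsetP s1 e ev).
have := dimv_disjoint_sum cap0.
have -> : (coordsp A + coordsp (~: A))%VS = fullv.
  apply/eqP; rewrite eqEsubv subvf; apply/subvP => v _; rewrite [v]sum_basis.
  apply: memv_suml => e _; apply: memvZ.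
  have s1 : supp (basis_vec e) \subset [set e].
    apply/subsetP => x; rewrite !inE ffunE.
    by case: (eqVneq x e) => // _; rewrite eqxx.
  case: (boolP (e \in A)) => eA.
    apply: (subvP (addvSl _ _)); rewrite mem_coordsp (subset_trans s1) //.
    by rewrite sub1set.
  apply: (subvP (addvSr _ _)); rewrite mem_coordsp (subset_trans s1) //.
  by rewrite sub1set inE.
rewrite dimvf => dE.
have : (\dim (coordsp (~: A)) <= #|~: A|)%N.
  by rewrite (leq_trans (dim_span _)) // size_map -cardE.
have dT : dim (gf2 E) = #|E| by rewrite -[RHS]muln1.
by rewrite -(leq_add2l (\dim (coordsp A))) -dE dT -(cardsC A) leq_add2r.
Qed.

Fact indep_sets_exchange V A F :
  A \in indep_sets V -> F \in indep_sets V -> (#|A| < #|F|)%N ->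
  exists2 e, e \in F :\: A & e |: A \in indep_sets V.
Proof.
have disj B : B \in indep_sets V -> (coordsp B :&: V = 0)%VS.
  move/indep_setsP => iB; apply/eqP; rewrite -subv0; apply/subvP => v.
  by case/memv_capP; rewrite mem_coordsp memv0 => sB vV; rewrite (iB v).
move=> iA iF ltAF; apply/exists_inP; apply: contraLR ltAF => /exists_inPn nex.
rewrite -leqNgt -!dim_coordsp -(leq_add2r (\dim V)).
rewrite -(dimv_disjoint_sum (disj _ iA)) -(dimv_disjoint_sum (disj _ iF)).
apply: dimvS; rewrite subv_add addvSr andbT.
apply/span_subvP => _ /mapP[e eF ->]; rewrite mem_enum in eF.
case: (boolP (e \in A)) => eA.
  apply: (subvP (addvSl _ _)); rewrite mem_coordsp.
  apply/subsetP => x; rewrite inE ffunE; case: (eqVneq x e) => [-> //|_].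
  by rewrite eqxx.
have := nex e; rewrite !inE eA eF negbK => /(_ isT).
case/existsP => v /and3P[vV nzv sv].
have ve : v e = 1.
  have : v e != 0.
    apply: contraNneq nzv => ve0; apply/eqP.
    move/indep_setsP: iA; apply => //; apply/subsetP => x xv.
    have := subsetP sv x xv; rewrite !inE => /orP[/eqP xe|//].
    by move: xv; rewrite inE xe ve0 eqxx.
  by case: (v e) => [[|[|k]]] //= lt nz; apply/val_inj.
rewrite -[basis_vec e](subrK v); apply: memv_add => //.
rewrite mem_coordsp; apply/subsetP => x; rewrite inE !ffunE.
case: (eqVneq x e) => [->|ne]; first by rewrite ve subrr eqxx.
rewrite sub0r oppr_eq0 => nz; have xv : x \in supp v by rewrite inE.
by have := subsetP sv x xv; rewrite !inE (negbTE ne).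
Qed.

Definition matroid_of V : matroid E :=
  Matroid (indep_sets0 V) (@indep_setsS V) (@indep_sets_exchange V).

Lemma perp_dim W : (\dim {:gf2 E} <= \dim W + \dim (perp W))%N.
Proof.
pose h (w : gf2 E) : gf2 'I_(\dim W) := 
    [ffun i : 'I_(\dim W) => bform w (vbasis W)`_(val i)].
have h_lin : linear h.
  by move=> a x y; apply/ffunP => i; rewrite !ffunE bform_is_linear.
pose m := GRing.isLinear.Build _ _ _ _ _ h_lin.
pose f : {linear gf2 E -> gf2 'I_(\dim W)} := HB.pack h m.
have fE : linfun h =1 h by exact: (lfunE f).
rewrite -(limg_ker_dim (linfun h)) capfv addnC leq_add //.
  by rewrite (leq_trans (dimvS (subvf _))) // dimvf /dim /= card_ord muln1.
apply/dimvS/subvP => w; rewrite memv_ker fE => /eqP hw.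
apply/perpP => v vW; rewrite bformC -linfun_bform.
suff /subvP/(_ _ vW) : (W <= lker (linfun (fun v : gf2 E => bform v w)))%VS.
  by rewrite memv_ker => /eqP.
rewrite -(span_basis (vbasisP W)); apply/span_subvP => _ /(nthP 0)[i iW <-].
rewrite size_tuple in iW; rewrite memv_ker linfun_bform bformC.
by have /ffunP/(_ (Ordinal iW)) := hw; rewrite !ffunE /= => ->.
Qed.

Lemma pedestrian_sum W : pedestrian W -> (W + perp W = fullv)%VS.
Proof.
move/eqP => ped; apply/eqP; rewrite eqEdim subvf /=.
by rewrite dimv_disjoint_sum // perp_dim.
Qed.

Lemma projmx_spec W x w : pedestrian W -> w \in W ->
  bform (daddv_pi W (perp W) x) w = bform x w.
Proof.
move=> ped wW; have xWW : x \in (W + perp W)%VS by rewrite pedestrian_sum ?memvf.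
rewrite -{2}(daddv_pi_add (eqP ped) xWW) bformDl.
by have /perpP/(_ _ wW) -> := memv_pi (perp W) W x; rewrite addr0.
Qed.

Lemma projmx_sym W e f : pedestrian W -> projmx W e f = projmx W f e.
Proof.
move=> ped; rewrite /projmx -[LHS]bform_basis -[RHS]bform_basis.
rewrite bformC [RHS]bformC -(projmx_spec _ ped (memv_pi _ _ _)).
by rewrite -(projmx_spec (basis_vec f) ped (memv_pi _ _ _)) bformC.
Qed.

Lemma radical_compl_pedestrian V W : radical_compl V W -> pedestrian W.
Proof.
case/andP => /eqP VE /eqP cap0; rewrite /pedestrian -subv0 -cap0.
apply/subvP => w /memv_capP[wW wp]; rewrite memv_cap wW.
have wV : w \in V by rewrite -VE (subvP (addvSl _ _)).
rewrite memv_cap wV; apply/perpP => v; rewrite -{1}VE.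
case/memv_addP => x xW [r rR ->]; rewrite bformDr (perpP _ _ wp) // add0r.
by case/memv_capP: rR => _ /perpP/(_ _ wV); rewrite bformC.
Qed.

Lemma tildeV_compl V : radical_compl V (tildeV V).
Proof.
rewrite /radical_compl /tildeV capv_diff eqxx andbT addv_diff.
by apply/eqP/addv_idPl/capvSl.
Qed.

Lemma notin_Fminus V r e : e \notin Fminus V -> r \in radical V -> r e = 0.
Proof.
move=> eF rR; apply/eqP; apply: contraNT eF => nz.
by apply/bigcupP; exists r; rewrite // inE.
Qed.

Lemma projmx_radical_compl V W1 W2 e f :
  radical_compl V W1 -> radical_compl V W2 ->
  e \in Fset V -> f \in Fset V -> projmx W1 e f = projmx W2 e f.
Proof.
rewrite !in_setC => c1 c2 eF fF.
have p1 := radical_compl_pedestrian c1; have p2 := radical_compl_pedestrian c2.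
have [/eqP V1 _] := andP c1; have [/eqP V2 _] := andP c2.
set u1 := daddv_pi W1 (perp W1) (basis_vec f).
set u2 := daddv_pi W2 (perp W2) (basis_vec f).
have u1W : u1 \in W1 := memv_pi _ _ _; have u2W : u2 \in W2 := memv_pi _ _ _.
have u1V : u1 \in V by rewrite -V1 (subvP (addvSl _ _)).
have u2V : u2 \in V by rewrite -V2 (subvP (addvSl _ _)).
have key W u : pedestrian W -> (W + radical V = V)%VS -> u \in V ->
    u = daddv_pi W (perp W) (basis_vec f) -> forall v, v \in V -> bform u v = v f.
  move=> pW VW uV uE v; rewrite -{1}VW => /memv_addP[w wW [r rR ->]].
  rewrite bformDr ffunE uE projmx_spec // -uE bformC bform_basis.
  rewrite (notin_Fminus fF rR); congr (_ + _); rewrite bformC.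
  by case/memv_capP: rR => _ /perpP; apply.
have uR : u1 - u2 \in radical V.
  rewrite memv_cap memvB //; apply/perpP => v vV; rewrite -linfun_bform linearB /= !linfun_bform.
  by rewrite (key W1) // (key W2) // subrr.
by apply/eqP; rewrite -subr_eq0; have := notin_Fminus eF uR; rewrite !ffunE => ->.
Qed.

Definition tilde_adj V : rel {e : E | e \in Fset V} :=
  fun e f => projmx (tildeV V) (val e) (val f) != 0.

Fact tilde_adj_sym V : symmetric (@tilde_adj V).
Proof.
move=> e f; rewrite /tilde_adj projmx_sym //.
exact: radical_compl_pedestrian (tildeV_compl V).
Qed.

Definition tildeG V : looped_graph := LoopedGraph (@tilde_adj_sym V).

End BinarySpaces.

(* Main.v *)
(** A set is dependent in M(V) exactly when it contains the support
    of a nonzero vector of V; over GF(2) a vector is its support, so, removing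
    such supports one at a time, M(V) determines V.  The graph is then transported
    along the bijection: for e and f outside F_{-1}, the entry Q_{ef} is the e-th
    coordinate of any u in V representing the functional v |-> v f on V. *)

From HB Require Import structures.
Require Import Defs.
From mathcomp Require Import all_boot all_order all_algebra.

Set Implicit Arguments.
Unset Strict Implicit.
Unset Printing Implicit Defensive.

Import GRing.Theory.
Local Open Scope ring_scope.

Lemma F2_neq0 (x : 'F_2) : x != 0 -> x = 1.
Proof. by case: x => [[|[|k]]] //= lt nz; apply/val_inj. Qed.

Section BinarySpaces.

Variable E : finType.
Implicit Types (u v : gf2 E) (V W : {vspace gf2 E}).

Lemma supp_eq0 v : (supp v == set0) = (v == 0).
Proof.
apply/eqP/eqP => [s0 | ->]; last by apply/setP => e; rewrite !inE ffunE eqxx.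
by apply/ffunP => e; have := in_set0 e; rewrite -s0 inE ffunE => /negbFE/eqP.
Qed.

(** Nonzero entries over GF(2) are all 1, so subtraction cancels on the whole of [supp u]. *)
Lemma suppB u v : supp u \subset supp v -> supp (v - u) = supp v :\: supp u.
Proof.
move=> suv; apply/setP => e; rewrite !inE !ffunE.
have [-> | /F2_neq0 ue] := eqVneq (u e) 0; first by rewrite subr0.
have /(subsetP suv) : e \in supp u by rewrite inE ue.
by rewrite inE ue => /F2_neq0 ->; rewrite subrr.
Qed.

Lemma indep_sets_inj : injective (@indep_sets E).
Proof.
(* One inclusion is proved by induction on a bound for the support size. [V] and [W] stay general
   because the induction also needs the reverse inclusion for smaller vectors. *)
suff sub n V W v : indep_sets V = indep_sets W -> (#|supp v| < n)%N ->
    v \in V -> v \in W.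
  by move=> V W VW; apply/vspaceP => v; apply/idP/idP; apply: sub (ltnSn _).
elim: n V W v => // n IHn V W v VW; rewrite ltnS => vn vV.
have [-> | nzv] := eqVneq v 0; first exact: mem0v.
have /existsP[u /and3P[uW nzu suv]] :
    [exists u : gf2 E, [&& u \in W, u != 0 & supp u \subset supp v]].
  have : supp v \notin indep_sets W.
    by rewrite -VW inE negbK; apply/existsP; exists v; rewrite vV nzv subxx.
  by rewrite inE negbK.
have ltBv : (#|supp (v - u)%R| < #|supp v|)%N.
  rewrite suppB // -[ltnRHS](cardsID (supp u)) (setIidPr suv).
  by rewrite -[ltnLHS]add0n ltn_add2r card_gt0 supp_eq0.
(* If the support of [u] is smaller, induction with [V] and [W] swapped puts [u] in [V]; then
   [v - u] lies in [V], is also smaller, and induction puts it in [W]. Otherwise the supports agree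
   and [v = u]. *)
have [suv_prop | ] := boolP (supp u \proper supp v).
  have uV : u \in V.
    by apply: (IHn W) => //; apply: leq_trans vn; apply: proper_card.
  rewrite -[v](subrK u) memvD //; apply: (IHn V) => //; last exact: memvB.
  exact: leq_trans vn.
rewrite properE suv negbK => svu.
suff /eqP : v - u == 0 by move/subr0_eq ->.
by rewrite -supp_eq0 suppB // setD_eq0.
Qed.

Definition tildeV_col V f : gf2 E :=
  daddv_pi (tildeV V) (perp (tildeV V)) (basis_vec f).

Lemma tildeV_col_mem V f : tildeV_col V f \in V.
Proof. exact: subvP (diffvSl V (radical V)) _ (memv_pi _ _ _). Qed.

(** Split [v = t + r] along the radical. Projecting [basis_vec f] keeps its pairing with [t], while
    [r] is orthogonal to [V] and vanishes at [f]. *)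
Lemma bform_tildeV_col V f v : f \in Fset V -> v \in V ->
  bform (tildeV_col V f) v = v f.
Proof.
rewrite in_setC => fF; have cV := tildeV_compl V.
have ped := radical_compl_pedestrian cV; have [/eqP VE _] := andP cV.
rewrite -{1}VE => /memv_addP[t tT [r rR ->]].
rewrite bformDr ffunE projmx_spec // bformC bform_basis (notin_Fminus fF rR).
by case/memv_capP: rR => _ /perpP/(_ _ (tildeV_col_mem V f)); rewrite bformC => ->.
Qed.

(* Two representatives of the functional differ by a radical vector, and those
   vanish on F. *)
Lemma projmx_tildeV V u e f : e \in Fset V -> f \in Fset V -> u \in V ->
  (forall v, v \in V -> bform u v = v f) -> projmx (tildeV V) e f = u e.
Proof.
move=> eF fF uV uf; have wV := tildeV_col_mem V f.
have wuR : tildeV_col V f - u \in radical V.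
  rewrite memv_cap memvB //; apply/perpP => v vV.
  by rewrite -linfun_bform linearB /= !linfun_bform uf // bform_tildeV_col ?subrr.
rewrite in_setC in eF; apply: subr0_eq.
by have := notin_Fminus eF wuR; rewrite !ffunE.
Qed.

End BinarySpaces.

Section Transport.

Variables (E E' : finType) (phi : E -> E') (psi : E' -> E).
Hypotheses (phiK : cancel phi psi) (psiK : cancel psi phi).
Variables (V : {vspace gf2 E}) (V' : {vspace gf2 E'}).

Definition pull (w : gf2 E') : gf2 E := [ffun e => w (phi e)].

Definition push (v : gf2 E) : gf2 E' := [ffun e => v (psi e)].

Fact pull_is_linear : linear pull.
Proof. by move=> a x y; apply/ffunP => e; rewrite !ffunE. Qed.

HB.instance Definition _ := GRing.isLinear.Build _ _ _ _ pull pull_is_linear.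

Lemma pushK : cancel push pull.
Proof. by move=> v; apply/ffunP => e; rewrite !ffunE phiK. Qed.

Lemma pullK : cancel pull push.
Proof. by move=> w; apply/ffunP => e; rewrite !ffunE psiK. Qed.

Lemma bform_pull v w : bform (pull v) (pull w) = bform v w.
Proof.
rewrite /bform [RHS](reindex phi) /=; last by exists psi => e _.
by apply: eq_bigr => e _; rewrite !ffunE.
Qed.

Lemma supp_pull w : supp (pull w) = phi @^-1: supp w.
Proof. by apply/setP => e; rewrite !inE ffunE. Qed.

(** The preimage of [V] under [pull] is a subspace with the same independent sets as [V'], so
    [indep_sets_inj] identifies the two. *)
Lemma mem_pull_indep :
  (forall A : {set E}, (phi @: A \in indep_sets V') = (A \in indep_sets V)) ->
  forall w, (pull w \in V) = (w \in V').
Proof.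
move=> indE w; suff <- : (linfun pull @^-1: V)%VS = V' by rewrite -memv_preim lfunE.
apply: indep_sets_inj; apply/setP => A.
have imK : phi @: (phi @^-1: A) = A.
  apply/setP => e; apply/imsetP/idP => [[x] | eA]; first by rewrite inE => xA ->.
  by exists (psi e); rewrite ?inE psiK.
(* Inclusion of preimages descends because [phi] is onto. *)
have preS (B : {set E'}) : (phi @^-1: B \subset phi @^-1: A) = (B \subset A).
  apply/idP/idP => [sBA | ]; last exact: preimsetS.
  apply/subsetP => e eB; rewrite -(psiK e).
  by have /(subsetP sBA) : psi e \in phi @^-1: B; rewrite inE ?psiK.
rewrite -[in RHS]imK indE; apply/indep_setsP/indep_setsP => iA v.
  move=> vV svA; rewrite -(pushK v) (iA (push v)) ?linear0 //.
    by rewrite -memv_preim lfunE /= pushK.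
  by rewrite -preS -supp_pull pushK.
rewrite -memv_preim lfunE /= -preS -supp_pull => vV svA.
by apply: (can_inj pullK); rewrite (iA _ vV svA) linear0.
Qed.

Hypothesis mem_pull : forall w, (pull w \in V) = (w \in V').

(** [pull] preserves [bform] and matches [V'] with [V], hence respects orthogonality to them. *)
Lemma mem_pull_radical w : (pull w \in radical V) = (w \in radical V').
Proof.
rewrite !memv_cap mem_pull; congr (_ && _).
apply/perpP/perpP => pw v vV; first by rewrite -bform_pull pw ?mem_pull.
by rewrite -(pushK v) bform_pull pw // -mem_pull pushK.
Qed.

Lemma mem_Fset_transport e : (phi e \in Fset V') = (e \in Fset V).
Proof.
rewrite !in_setC; congr negb; apply/bigcupP/bigcupP => [[r rR re] | [r rR re]].
  by exists (pull r); rewrite ?mem_pull_radical // supp_pull inE.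
exists (push r); first by rewrite -mem_pull_radical pushK.
by move: re; rewrite -{1}(pushK r) supp_pull inE.
Qed.

Lemma projmx_transport e f : e \in Fset V -> f \in Fset V ->
  projmx (tildeV V') (phi e) (phi f) = projmx (tildeV V) e f.
Proof.
move=> eF fF; set u := tildeV_col V f.
have uV : u \in V by exact: tildeV_col_mem.
(* [push u] need not lie in the chosen complement [tildeV V']; it suffices that it lies in [V'] and
   represents evaluation at [phi f]. *)
rewrite (@projmx_tildeV _ V' (push u)) ?mem_Fset_transport //.
- by rewrite ffunE phiK.
- by rewrite -mem_pull pushK.
- by move=> w wV; rewrite -bform_pull pushK bform_tildeV_col ?mem_pull // ffunE.
Qed.

Lemma tildeG_transport : graph_isom (tildeG V) (tildeG V').
Proof.
(* Vertices carry membership proofs, so [phi] and [psi] must first be restricted to the two vertex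
   sets. *)
have phiF (x : tildeG V) : phi (val x) \in Fset V'.
  by rewrite mem_Fset_transport (valP x).
have psiF (y : tildeG V') : psi (val y) \in Fset V.
  by rewrite -mem_Fset_transport psiK (valP y).
exists (fun x : tildeG V => exist _ (phi (val x)) (phiF x) : tildeG V').
  exists (fun y : tildeG V' => exist _ (psi (val y)) (psiF y) : tildeG V).
    by move=> x; apply: val_inj; rewrite /= phiK.
  by move=> y; apply: val_inj; rewrite /= psiK.
by move=> x y; rewrite /= /tilde_adj /= projmx_transport ?(valP x) ?(valP y).
Qed.

End Transport.

Theorem theorem8 (E E' : finType)
    (V : {vspace gf2 E}) (V' : {vspace gf2 E'}) :
  matroid_isom (matroid_of V) (matroid_of V') ->
  graph_isom (tildeG V) (tildeG V').
Proof.
case=> phi [psi phiK psiK] indE.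
by apply: (tildeG_transport phiK psiK); apply: (mem_pull_indep phiK psiK).
Qed.
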